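(* Let $m \geq 2$ and let $S$ be a nonempty finite set of positive integers that is sum-free modulo $m$ and has the property that whenever $s_{i_1}, s_{i_2}, s_{i_3}, s_{i_4} \in S$ satisfy $s_{i_1} + s_{i_2} \equiv s_{i_3} + s_{i_4} \pmod m$, then $s_{i_1} + s_{i_2} = s_{i_3} + s_{i_4}$. Let $A = \{um + s : u \geq 0,\ s \in S\}$; every $a \in A$ has a unique representation $a = u(a)m + s(a)$ with $u(a) \geq 0$ and $s(a) \in S$. For a positive integer $n$, let $\mathcal{A}(n)$ be the set of partitions of $n$ of the form $n = a_1 + \cdots + a_k$ with $a_i \in A$ and $u(a_1) > \cdots > u(a_k) \geq 0$, and let $p_{\mathcal{A}}(n) = |\mathcal{A}(n)|$. Let $B = \{um + s + s' : u \geq 1,\ s, s' \in S\}$ and $H = A \cup B$. Each $h \in H$ can be written uniquely as $h = v(h)m + t(h)$ with $v(h) \geq 0$ and $t(h) \in S \cup 2S$, where $2S = \{s + s' : s, s' \in S\}$. Let $\mathcal{H}(n)$ be the set of partitions $\pi' = (h_1,\ldots,h_d)$ of $n$, with parts listed in the order given by the following conditions, such that $h_i \in H$ for all $i$, $v(h_i) - v(h_{i+1}) \geq 3$ for $i = 1,\ldots,d-1$, and $v(h_i) - v(h_{i+1}) \geq 4$ whenever $h_{i+1} \in B$. For $h \in B$ let $r(h)$ be the number of ordered pairs $(s,s') \in S \times S$ with $s + s' = t(h)$, and for $h \in A$ let $r(h) = 1$. Then \[ p_{\mathcal{A}}(n) = \sum_{\substack{\pi' \in \mathcal{H}(n)\\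 \pi' = (h_1,\ldots,h_d)}} \prod_{i=1}^d r(h_i). \]
   Context: A set $S$ of integers is sum-free modulo $m$ if its elements are pairwise incongruent modulo $m$ and the congruence $s_{i_1} + s_{i_2} \equiv s_j \pmod m$ has no solution with $s_{i_1}, s_{i_2}, s_j \in S$. Elements of $S$ are not required to lie in $\{1,\ldots,m\}$. *)

(* Defs.v *)
(* MathComp world, with finmap and the classical layer of MathComp-Analysis. *)
From mathcomp Require Import all_boot finmap.
From mathcomp Require Import boolp classical_sets.

Set Implicit Arguments.
Unset Strict Implicit.
Unset Printing Implicit Defensive.

Definition sum_free_mod (m : nat) (S : {fset nat}) : Prop :=
  {in S &, forall s s' : nat, s = s' %[mod m] -> s = s'} /\
  {in S & &, forall s1 s2 s3 : nat, s1 + s2 <> s3 %[mod m]}.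

Definition dbl (S : {fset nat}) : {fset nat} :=
  [fset (s + s')%N | s in S, s' in S]%fset.

Definition setA (m : nat) (S : {fset nat}) : set nat :=
  [set a | exists u s : nat, s \in S /\ a = u * m + s]%classic.

Definition setB (m : nat) (S : {fset nat}) : set nat :=
  [set b | exists u s s' : nat,
     [/\ 1 <= u, s \in S, s' \in S & b = u * m + s + s']]%classic.

Definition setH (m : nat) (S : {fset nat}) : set nat :=
  (setA m S `|` setB m S)%classic.

(* [is_rep m T a (q, t)]: a = q m + t with q >= 0 and t in T. *)
Definition is_rep (m : nat) (T : {fset nat}) (a : nat) (qt : nat * nat) : Prop :=
  qt.2 \in T /\ a = qt.1 * m + qt.2.

(* Some representation of [a], or (0, 0) if there is none. *)
Definition rep (m : nat) (T : {fset nat}) (a : nat) : nat * nat :=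
  xget (0, 0) [set qt | is_rep m T a qt]%classic.

Definition uA (m : nat) (S : {fset nat}) (a : nat) : nat := (rep m S a).1.

Definition vH (m : nat) (S : {fset nat}) (h : nat) : nat :=
  (rep m (S `|` dbl S)%fset h).1.

Definition tH (m : nat) (S : {fset nat}) (h : nat) : nat :=
  (rep m (S `|` dbl S)%fset h).2.

(* A partition of n is stored as its nonincreasing list of positive parts; it
   has at most n parts, each at most n, so the bounds make the type finite
   without excluding any partition. *)
Definition is_intpart (n : nat) (p : seq nat) : bool :=
  [&& sorted geq p, all (ltn 0) p & sumn p == n].

Definition intpart (n : nat) : finType :=
  {p : n.-bseq 'I_n.+1 | is_intpart n (map val p)}.

Definition parts (n : nat) (p : intpart n) : seq nat := map val (val p).

(* The parts are listed by decreasing u (resp. v), which need not be their order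
   by size: hence the quantification over all listings of the parts. *)
Definition calA (m : nat) (S : {fset nat}) (n : nat) : {set intpart n} :=
  [set p : intpart n | has (fun a : seq nat =>
     all (mem (setA m S)) a && sorted (fun a1 a2 => uA m S a1 > uA m S a2) a)
     (permutations (parts p))].

Definition pA (m : nat) (S : {fset nat}) (n : nat) : nat := #|calA m S n|.

Definition gapH (m : nat) (S : {fset nat}) (h h' : nat) : bool :=
  (vH m S h' + 3 <= vH m S h) &&
  ((h' \in setB m S) ==> (vH m S h' + 4 <= vH m S h)).

Definition calH (m : nat) (S : {fset nat}) (n : nat) : {set intpart n} :=
  [set p : intpart n | has (fun h : seq nat =>
     all (mem (setH m S)) h && sorted (gapH m S) h)
     (permutations (parts p))].

Definition rH (m : nat) (S : {fset nat}) (h : nat) : nat :=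
  if h \in setB m S
  then #|[set x : S * S | fsval x.1 + fsval x.2 == tH m S h]|
  else 1.

(* Main.v *)
(* Let x stand for the generating polynomial of S and q for one unit of u (or
   v), and let N_j(x) be the generating function of the H-chains all of whose
   parts have v >= j, a part of A contributing x and a part of B contributing
   x^2 (there are r(h) ordered pairs behind it). Removing the least part gives
     N_j(x) = N_{j+1}(x) + x q^j N_{j+3}(x) + x^2 q^j N_{j+4}(x)   (j >= 1),
   while all H-chains together give F(x) = N_1(x) + x N_3(x), as no part of B
   has v = 0. Replacing x by xq in the recurrence shows that
   N_{j+1}(x) + x N_{j+2}(x) and (1 + x) N_j(xq) satisfy the same recurrence,
   hence are equal, and this yields F(x) = (1 + x) F(xq). The generating
   function of the A-chains satisfies the same equation, so both are
   the product of the 1 + x q^j. *)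

Require Import Defs.
From mathcomp Require Import all_boot finmap zify.
From mathcomp Require Import boolp classical_sets.

Set Implicit Arguments.
Unset Strict Implicit.
Unset Printing Implicit Defensive.

(* Generating functions enter only through their pairing with a test function
   psi k n, where k is the exponent of x and n the sum of the parts; multiplying
   a series by a monomial then shifts psi, with no truncated subtraction.
   Vanishing of psi makes every pairing a finite sum. *)
Definition vanish K (psi : nat -> nat -> nat) :=
  forall k n, 0 < k -> K <= n -> psi k n = 0.

Lemma vanish_shift K psi c h :
  vanish K psi -> vanish K (fun k n => psi (c + k) (h + n)).
Proof. by move=> psi0 k n k_gt0 leKn; apply: psi0; lia. Qed.

(** * Partitions as multisets of parts *)

Lemma parts_perm_inj n (p q : intpart n) :
  perm_eq (parts p) (parts q) -> p = q.
Proof.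
move=> eq_pq; have [/and3P[sp _ _] /and3P[sq _ _]] := (valP p, valP q).
have: parts p = parts q.
  apply: (sorted_eq _ _ sp sq eq_pq) => [b a c|a b]; rewrite /geq /=; lia.
by move/(inj_map val_inj)/val_inj/val_inj.
Qed.

Lemma parts_ex n (l : seq nat) : all (ltn 0) l -> sumn l = n ->
  exists p : intpart n, perm_eq l (parts p).
Proof.
move=> l_gt0 sum_l; pose s := sort geq l.
have eq_sl : perm_eq s l by rewrite perm_sort.
have sorted_s : sorted geq s.
  by apply: sort_sorted => a b; rewrite /geq /= leq_total.
have s_gt0 : all (ltn 0) s by rewrite (perm_all _ eq_sl).
have sum_s : sumn s = n by rewrite (perm_sumn eq_sl).
have sz_s : size s <= n.
  rewrite -sum_s; elim: (s) s_gt0 => //= a r IHr /andP[a_gt0 /IHr]; lia.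
have le_s a : a \in s -> a <= n.
  rewrite -sum_s; elim: (s) => //= b r IHr.
  by rewrite inE => /predU1P[->|/IHr]; lia.
pose t : seq 'I_n.+1 := map inord s.
have val_t : map val t = s.
  rewrite -map_comp -[RHS]map_id; apply/eq_in_map => a /le_s le_an /=.
  by rewrite inordK.
have sz_t : size t <= n by rewrite size_map.
have t_part : is_intpart n (map val (Bseq sz_t)).
  by rewrite /= val_t; apply/and3P; split=> //; apply/eqP.
by exists (Sub (Bseq sz_t) t_part); rewrite /parts /= val_t perm_sym.
Qed.

(** * Chains of parts separated by gaps *)

Section Chains.

(** [opts j] holds the parts of level j; [g h] is the gap required above h, [wt h] its degree in x,
    [w h] its multiplicity. Both kinds of partitions are instances. *)
Variables (opts : nat -> seq nat) (lev g wt w : nat -> nat).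
Hypothesis g_gt0 : forall h, 0 < g h.
Hypothesis wt_gt0 : forall h, 0 < wt h.
Hypothesis opts_ge : forall j h, h \in opts j -> j <= h.
Hypothesis lev_opts : forall j h, h \in opts j -> lev h = j.
Hypothesis opts_uniq : forall j, uniq (opts j).

(* Increasing lists whose least level is at least j. The fuel K does not bound
   the levels sharply, but it is irrelevant for test functions vanishing from K
   on: see csum_fuel. *)
Fixpoint chains K j : seq (seq nat) :=
  if K is K'.+1 then
    chains K' j.+1 ++ [seq h :: l | h <- opts j, l <- chains K' (j + g h)]
  else [:: [::]].

Definition csum K j (psi : nat -> nat -> nat) :=
  \sum_(l <- chains K j) (\prod_(h <- l) w h) * psi (sumn (map wt l)) (sumn l).

Lemma csumS K j psi : csum K.+1 j psi = csum K j.+1 psi +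
  \sum_(h <- opts j) w h * csum K (j + g h) (fun k n => psi (wt h + k) (h + n)).
Proof.
rewrite /csum /= big_cat big_allpairs_dep /=; congr (_ + _).
apply: eq_bigr => h _; rewrite big_distrr; apply: eq_bigr => l _ /=.
by rewrite big_cons mulnA.
Qed.

Lemma csum_sum (I : Type) (r : seq I) K j (F : I -> nat -> nat -> nat) :
  csum K j (fun k n => \sum_(i <- r) F i k n) = \sum_(i <- r) csum K j (F i).
Proof.
rewrite /csum exchange_big; apply: eq_bigr => l _; exact: big_distrr.
Qed.

(** A nonempty chain from level j on has positive weight and sum at least j, so only the empty chain
    survives. *)
Lemma csum_high f K j psi : vanish K psi -> K <= j -> csum f j psi = psi 0 0.
Proof.
elim: f j psi => [|f IHf] j psi psi0 leKj.
  by rewrite /csum /= big_seq1 big_nil mul1n.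
rewrite csumS IHf ?(leqW leKj) // big_seq big1 ?addn0 // => h /opts_ge lejh.
rewrite IHf; [|exact: vanish_shift | by lia].
by rewrite psi0 ?muln0 //; [have := wt_gt0 h | ]; lia.
Qed.

(** A chain missed for want of fuel has a part of level at least f + j, hence a sum at least K,
    where [psi] vanishes. *)
Lemma csum_fuel f K j psi : vanish K psi -> K <= f + j ->
  csum f.+1 j psi = csum f j psi.
Proof.
elim: f j psi => [|f IHf] j psi psi0 leKj; first by rewrite !(csum_high _ psi0).
rewrite csumS [RHS]csumS IHf //; last by lia.
congr (_ + _); apply: eq_bigr => h _; congr (_ * _).
by apply: IHf; [exact: vanish_shift | have := g_gt0 h; lia].
Qed.

Lemma csum_rec K j psi : vanish K psi -> csum K j psi = csum K j.+1 psi +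
  \sum_(h <- opts j) w h * csum K (j + g h) (fun k n => psi (wt h + k) (h + n)).
Proof. by move=> psi0; rewrite -(csum_fuel psi0) ?csumS // leq_addr. Qed.

Fixpoint is_chain j l :=
  if l is h :: l' then
    [&& h \in opts (lev h), j <= lev h & is_chain (lev h + g h) l']
  else true.

Lemma is_chain_le i j l : i <= j -> is_chain j l -> is_chain i l.
Proof.
by case: l => //= h l leij /and3P[-> lejh ->]; rewrite (leq_trans leij).
Qed.

Lemma is_chain_sorted l : is_chain 0 l =
  all (fun h => h \in opts (lev h)) l &&
  sorted (fun a b => lev a + g a <= lev b) l.
Proof.
case: l => //= h l; rewrite -andbA; congr (_ && _).
elim: l h => //= h' l IHl h; rewrite IHl.
by case: (_ \in _); case: (_ <= _); case: (all _ _).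
Qed.

Lemma chains_is_chain K j l : l \in chains K j -> is_chain j l.
Proof.
elim: K j l => [|K IHK] j l /=; first by rewrite inE => /eqP->.
rewrite mem_cat => /orP[/IHK /is_chain_le-> // |].
case/allpairsPdep => h [l' [hj /IHK l'ch ->]] /=.
by rewrite (lev_opts hj) hj leqnn.
Qed.

Lemma mem_chains K j l :
  is_chain j l -> all (fun h => lev h < j + K) l -> l \in chains K j.
Proof.
elim: K j l => [|K IHK] j [|h l] //=.
- by case/and3P=> _ lejh _; lia.
- by move=> _ _; rewrite mem_cat IHK.
case/and3P=> hopts lejh lch /andP[hlt llt]; rewrite mem_cat.
have [eqjh|nejh] := eqVneq j (lev h); last first.
  rewrite IHK //= ?hopts ?lch ?andbT; first by lia.
  by apply/andP; split; [lia | apply: sub_all llt => x /=; lia].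
apply/orP; right; apply/allpairsPdep; exists h, l; rewrite eqjh; split => //.
apply: IHK => //; apply: sub_all llt => x /=; have := g_gt0 h; lia.
Qed.

Lemma chains_uniq K j : uniq (chains K j).
Proof.
elim: K j => [|K IHK] j //=; rewrite cat_uniq IHK /=; apply/andP; split.
  (* The lists beginning with some h of [opts j] start at level j exactly, all others strictly
     higher. *)
  apply/hasPn => _ /allpairsPdep[h [l [hj _ ->]]] /=.
  by apply/negP => /chains_is_chain /=; rewrite (lev_opts hj) ltnn andbF.
apply: allpairs_uniq_dep => //= -[h l] [h' l'] _ _ /= [-> ->] //.
Qed.

(** As [g] is positive, the gap condition is a strict order, so a partition has at most one
    admissible listing. Chains increase while [e] describes decreasing listings, hence the
    reversals. Fuel above n suffices: a level is at most its part, which is at most n. *)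
Lemma sum_intpart_chains (P : pred nat) (e : rel nat) n K :
  n < K ->
  (forall h, P h = (h \in opts (lev h))) ->
  (forall h, P h -> 0 < h) ->
  (forall a b, e b a = (lev a + g a <= lev b)) ->
  \sum_(p in [set p : intpart n |
      has (fun a => all P a && sorted e a) (permutations (parts p))])
    \prod_(h <- parts p) w h = csum K 0 (fun _ s => s == n).
Proof.
move=> ltnK P_opts P_gt0 eE; set X := [set p | _].
pose r a b := lev a + g a <= lev b.
have r_tr : transitive r by move=> b a c; rewrite /r; have := g_gt0 b; lia.
have r_irr : irreflexive r by move=> a; rewrite /r; have := g_gt0 a; lia.
have chainE l : is_chain 0 l = all P l && sorted r l.
  by rewrite is_chain_sorted; congr (_ && _); apply: eq_all.
have lev_le h : P h -> lev h <= h by rewrite P_opts => /opts_ge.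
pose L := [seq l <- chains K 0 | sumn l == n].
have memL l : (l \in L) = [&& all P l, sorted r l & sumn l == n].
  rewrite mem_filter andbC andbA -chainE; case: eqP => sum_l; rewrite ?andbF //.
  rewrite !andbT; apply/idP/idP => [/chains_is_chain //|l_ch].
  apply: mem_chains => //; rewrite add0n; apply/allP => h hl.
  move: l_ch; rewrite chainE => /andP[/allP Pl _].
  apply: leq_ltn_trans (lev_le _ (Pl h hl)) (leq_ltn_trans _ ltnK).
  by rewrite -sum_l (perm_sumn (perm_to_rem hl)) /= leq_addr.
have uniqL : uniq L by apply/filter_uniq/chains_uniq.
have XP p : reflect (exists2 l, l \in L & perm_eq l (parts p)) (p \in X).
  rewrite inE; apply: (iffP hasP) => [[a]|[l]].
    rewrite mem_permutations => eq_ap /andP[Pa e_a].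
    exists (rev a); last by rewrite perm_rev.
    rewrite memL all_rev Pa rev_sorted (perm_sumn (s2 := parts p)) ?perm_rev //.
    have /and3P[_ _ ->] := valP p; rewrite andbT.
    by rewrite -(eq_sorted (e := e)).
  rewrite memL => /and3P[Pl r_l _] eq_lp; exists (rev l).
    by rewrite mem_permutations perm_rev.
  by rewrite all_rev Pl rev_sorted -(eq_sorted (e := r)).
(* Double counting of the pairs of a partition and a chain listing its parts. *)
transitivity (\sum_(p : intpart n) \sum_(l <- L | perm_eq l (parts p))
                \prod_(h <- l) w h).
  rewrite big_mkcond; apply: eq_bigr => p _; case: XP => [[l lL eq_lp]|nex].
    rewrite -[RHS]big_filter; set L' := filter _ L.
    suff -> : L' = [:: l] by rewrite big_seq1; apply/perm_big; rewrite perm_sym.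
    apply/perm_small_eq => //; apply: uniq_perm => //; first exact: filter_uniq.
    move=> l'; rewrite mem_filter inE; apply/andP/eqP => [[eq_l'p l'L]|-> //].
    move: lL l'L; rewrite !memL => /and3P[_ rl _] /and3P[_ rl' _].
    apply: (irr_sorted_eq r_tr r_irr) => //; apply: perm_mem.
    by rewrite (perm_trans eq_l'p) // perm_sym.
  by rewrite big_seq_cond big1 // => l /andP[lL eq_lp]; case: nex; exists l.
rewrite (exchange_big_dep predT) //= /csum.
rewrite [RHS](bigID (fun l => sumn l == n)) /=.
rewrite [X in _ + X]big1 ?addn0; last first.
  by move=> l /negbTE->; rewrite muln0.
rewrite big_filter -big_filter -[RHS]big_filter -/L.
rewrite [LHS]big_seq [RHS]big_seq; apply: eq_bigr => l.
rewrite memL => /and3P[Pl _ /[dup] /eqP sum_l ->]; rewrite muln1.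
have [p eq_lp] : exists p : intpart n, perm_eq l (parts p).
  by apply: parts_ex => //; apply: sub_all Pl => h /P_gt0.
rewrite (big_pred1 p) // => q /=; apply/idP/eqP => [eq_lq|-> //].
apply: parts_perm_inj; rewrite perm_sym in eq_lq.
exact: perm_trans eq_lq eq_lp.
Qed.

End Chains.

(** * Functional equations in x and q *)

Section Operators.

Variables (m : nat) (S : seq nat).

Definition shiftq j (psi : nat -> nat -> nat) k n := psi k (j * m + n).

(* The transpose of multiplication by x, where x = sum of q^(s/m) over S. *)
Definition mulx (psi : nat -> nat -> nat) k n := \sum_(s <- S) psi k.+1 (s + n).

(** The transpose of x -> xq: a term of degree k in x gains k units of q, each worth m. *)
Definition substxq (psi : nat -> nat -> nat) k n := psi k (k * m + n).

Lemma vanish_shiftq K j psi : vanish K psi -> vanish K (shiftq j psi).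
Proof. by move=> psi0 k n k_gt0 leKn; apply: psi0; lia. Qed.

Lemma vanish_mulx K psi : vanish K psi -> vanish K (mulx psi).
Proof.
by move=> psi0 k n k_gt0 leKn; rewrite /mulx big1 // => s _; apply: psi0; lia.
Qed.

Lemma vanish_substxq K psi : vanish K psi -> vanish K (substxq psi).
Proof. by move=> psi0 k n k_gt0 leKn; apply: psi0; lia. Qed.

Lemma shiftq0 psi : shiftq 0 psi = psi.
Proof. by []. Qed.

Lemma shiftq_mulx j psi : shiftq j (mulx psi) = mulx (shiftq j psi).
Proof.
apply/funext => k; apply/funext => n; apply: eq_bigr => s _.
by rewrite /shiftq addnCA.
Qed.

(** The substitution turns the factor x q^j into x q^(j+1); transposes compose in reverse order. *)
Lemma mulx_substxq j psi :
  mulx (shiftq j (substxq psi)) = substxq (mulx (shiftq j.+1 psi)).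
Proof.
apply/funext => k; apply/funext => n; apply: eq_bigr => s _.
by congr psi; lia.
Qed.

Lemma mulx2_substxq j psi : mulx (mulx (shiftq j (substxq psi))) =
  substxq (mulx (mulx (shiftq j.+2 psi))).
Proof.
rewrite mulx_substxq -[substxq _ in LHS]shiftq0 mulx_substxq shiftq_mulx.
suff -> : shiftq 1 (shiftq j.+1 psi) = shiftq j.+2 psi by [].
by apply/funext => k; apply/funext => n; congr psi; lia.
Qed.

(** [N] is meant for H-chains and [D] for A-chains. The bound M of [N_high] and [D_high] is
    independent of K, as [N_eq_D] lowers it to 0. *)
Variables (K : nat) (N D : nat -> (nat -> nat -> nat) -> nat).
Hypothesis m_gt0 : 0 < m.
Hypothesis N_high : forall M j psi, vanish M psi -> M <= j -> N j psi = psi 0 0.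
Hypothesis N_rec : forall j psi, vanish K psi -> 0 < j -> N j psi =
  N j.+1 psi + N (j + 3) (mulx (shiftq j psi))
  + N (j + 4) (mulx (mulx (shiftq j psi))).
Hypothesis D_high : forall M j psi, vanish M psi -> M <= j -> D j psi = psi 0 0.
Hypothesis D_rec : forall j psi, vanish K psi ->
  D j psi = D j.+1 psi + D j.+1 (mulx (shiftq j psi)).

(* In terms of series, N_{j+1}(x) + x N_{j+2}(x) = (1 + x) N_j(xq); the base case
   of the descending induction is that both sides tend to 1 + x. *)
Lemma N_substxq j psi : vanish K psi -> 0 < j ->
  N j.+1 psi + N j.+2 (mulx psi) = N j (substxq psi) + N j (substxq (mulx psi)).
Proof.
have [d] := ubnP (K - j); elim: d => // d IHd in j psi * => ltKd psi0 j_gt0.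
have v1 := vanish_mulx psi0; have v2 := vanish_substxq psi0.
have v3 := vanish_substxq v1.
have [leKj|ltjK] := leqP K j.
  by rewrite (N_high psi0) ?(N_high v1) ?(N_high v2) ?(N_high v3) //; lia.
have va := vanish_mulx (@vanish_shiftq _ (j.+1) _ psi0).
have vb := vanish_mulx (vanish_mulx (@vanish_shiftq _ (j.+2) _ psi0)).
rewrite (N_rec psi0) // (N_rec v1) // (N_rec v2) // (N_rec v3) //.
(* The three instances carry the factors 1, x q^(j+1) and x^2 q^(j+2) of the recurrence for N_j(xq);
   their sum is the claim, regrouped. *)
have := IHd j.+1 psi ltac:(lia) psi0 ltac:(lia).
have := IHd (j + 3) _ ltac:(lia) va ltac:(lia).
have := IHd (j + 4) _ ltac:(lia) vb ltac:(lia).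
rewrite !mulx2_substxq !mulx_substxq !shiftq_mulx !addSn !addnS !addn0.
lia.
Qed.

(** Expanding N_1 gives F = (N_2 + x N_3) + xq (N_4 + x N_5), and [N_substxq] at levels 1 and 3
    extracts 1 + x from both brackets. *)
Lemma NF_substxq psi : vanish K psi ->
  N 1 psi + N 3 (mulx psi) =
  (N 1 (substxq psi) + N 3 (mulx (substxq psi))) +
  (N 1 (substxq (mulx psi)) + N 3 (mulx (substxq (mulx psi)))).
Proof.
move=> psi0; rewrite (N_rec psi0) //.
have mulx_subst phi : mulx (substxq phi) = substxq (mulx (shiftq 1 phi)).
  exact: mulx_substxq 0 phi.
rewrite !mulx_subst shiftq_mulx -[1 + 3]/4 -[1 + 4]/5.
have va := vanish_mulx (@vanish_shiftq _ 1 _ psi0).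
by move: (N_substxq psi0 (ltn0Sn 0)) (N_substxq va (ltn0Sn 2)); lia.
Qed.

Lemma D_substxq j psi : vanish K psi -> D j.+1 psi = D j (substxq psi).
Proof.
have [d] := ubnP (K - j); elim: d => // d IHd in j psi * => ltKd psi0.
have v2 := vanish_substxq psi0.
have [leKj|ltjK] := leqP K j.
  by rewrite (D_high psi0) ?(D_high v2) //; lia.
rewrite (D_rec _ psi0) (D_rec _ v2) mulx_substxq -!IHd //; try lia.
exact/vanish_mulx/vanish_shiftq.
Qed.

(** Both sides satisfy F(x) = (1 + x) F(xq). Passing to xq lowers the vanishing bound, because k m
    >= 1 for k > 0; at bound 0 only [psi 0 0] remains. *)
Lemma N_eq_D M psi : vanish M psi -> vanish K psi ->
  N 1 psi + N 3 (mulx psi) = D 0 psi.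
Proof.
elim: M psi => [|M IHM] psi psiM psiK.
  have v1 := vanish_mulx psiM.
  rewrite (N_high psiM) // (N_high v1) // (D_high psiM) // /mulx big1 ?addn0 //.
  by move=> s _; apply: psiM.
have psi'M : vanish M (substxq psi).
  by move=> k n k_gt0 leMn; apply: psiM => //; nia.
have xpsi'M : vanish M (substxq (mulx psi)).
  by move=> k n k_gt0 leMn; apply: (vanish_mulx psiM) => //; nia.
have v1 := vanish_mulx psiK; have v2 := vanish_substxq psiK.
rewrite NF_substxq // !IHM //; last exact: vanish_substxq.
by rewrite (D_rec _ psiK) shiftq0 !D_substxq.
Qed.

End Operators.

(** * Representations modulo m and the parts of each level *)

Lemma rep_unique m (T : {fset nat}) a : 0 < m ->
  {in T &, forall t t' : nat, t = t' %[mod m] -> t = t'} ->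
  forall qt qt' : nat * nat, is_rep m T a qt -> is_rep m T a qt' -> qt = qt'.
Proof.
move=> m_gt0 T_inj [q t] [q' t'] [/= tT ->] [/= t'T eq_a].
have eq_t : t = t' by apply: T_inj => //; rewrite -(modnMDl q) eq_a modnMDl.
move: eq_a; rewrite eq_t => /addIn/eqP; rewrite eqn_pmul2r // => /eqP-> //.
Qed.

Lemma repE m (T : {fset nat}) q t : 0 < m ->
  {in T &, forall t t' : nat, t = t' %[mod m] -> t = t'} ->
  t \in T -> rep m T (q * m + t) = (q, t).
Proof.
move=> m_gt0 T_inj tT; have qtP : is_rep m T (q * m + t) (q, t) by [].
by apply: xget_unique => // qt /(rep_unique m_gt0 T_inj qtP).
Qed.

Section SumFree.

Variables (m : nat) (S : {fset nat}).
Hypothesis m_gt0 : 0 < m.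
Hypothesis S_gt0 : forall s : nat, s \in S -> 0 < s.
Hypothesis S_free : sum_free_mod m S.
Hypothesis S_sum : forall s1 s2 s3 s4 : nat,
  s1 \in S -> s2 \in S -> s3 \in S -> s4 \in S ->
  s1 + s2 = s3 + s4 %[mod m] -> s1 + s2 = s3 + s4.

Let S_inj : {in S &, forall s s' : nat, s = s' %[mod m] -> s = s'}.
Proof. by case: S_free. Qed.

Lemma mem_dblP t :
  reflect (exists s s', [/\ s \in S, s' \in S & t = s + s']) (t \in dbl S).
Proof.
apply: (iffP (imfset2P _ _ _ _ _)) => [[s sS [s' s'S ->]]|[s [s' [sS s'S ->]]]].
  by exists s, s'.
by exists s => //; exists s'.
Qed.

(** Sum-freeness separates elements of S from each other and from sums; the hypothesis on sums
    separates distinct sums. *)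
Lemma S_dbl_inj : {in (S `|` dbl S)%fset &, forall t t' : nat,
  t = t' %[mod m] -> t = t'}.
Proof.
move=> t t'; rewrite !in_fsetU.
case/orP=> [tS|/mem_dblP[s1 [s2 [s1S s2S ->]]]];
  case/orP=> [t'S|/mem_dblP[s3 [s4 [s3S s4S ->]]]].
- exact: S_inj.
- by move/esym; case: S_free => _ /(_ _ _ _ s3S s4S tS).
- by case: S_free => _ /(_ _ _ _ s1S s2S t'S).
- exact: S_sum.
Qed.

Lemma uAE j s : s \in S -> uA m S (j * m + s) = j.
Proof. by move=> sS; rewrite /uA repE. Qed.

Lemma vHE j t : t \in (S `|` dbl S)%fset -> vH m S (j * m + t) = j.
Proof. by move=> tT; rewrite /vH (repE _ _ S_dbl_inj). Qed.

Lemma tHE j t : t \in (S `|` dbl S)%fset -> tH m S (j * m + t) = t.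
Proof. by move=> tT; rewrite /tH (repE _ _ S_dbl_inj). Qed.

Definition optsA j := [seq j * m + s | s <- S].

(** Each value of s + s' occurs once, its multiplicity being left to [rH]; level 0 is empty since B
    requires u >= 1. *)
Definition optsB j := if 0 < j then [seq j * m + t | t <- dbl S] else [::].

Definition optsH j := optsA j ++ optsB j.

Lemma optsAP j h :
  reflect (exists2 s, s \in S & h = j * m + s) (h \in optsA j).
Proof. exact: mapP. Qed.

Lemma optsBP j h :
  reflect (exists s s', [/\ 0 < j, s \in S, s' \in S & h = j * m + s + s'])
    (h \in optsB j).
Proof.
rewrite /optsB; case: ifPn => [j_gt0|/negP nj]; last first.
  by constructor=> -[s [s' [j_gt0 _ _ _]]]; case: nj.
apply: (iffP mapP) => [[_ /mem_dblP[s [s' [sS s'S ->]]] ->]|].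
  by exists s, s'; rewrite addnA.
case=> s [s' [_ sS s'S ->]]; exists (s + s'); rewrite ?addnA //.
by apply/mem_dblP; exists s, s'.
Qed.

Lemma mem_setA h : (h \in setA m S) = (h \in optsA (uA m S h)).
Proof.
apply/idP/optsAP => [/set_mem[u [s [sS ->]]]|[s sS ->]].
  by rewrite uAE //; exists s.
by apply/mem_set; exists (uA m S h), s.
Qed.

Lemma optsH_vH j h : h \in optsH j -> vH m S h = j.
Proof.
rewrite mem_cat => /orP[/optsAP[s sS ->]|/optsBP[s [s' [_ sS s'S ->]]]].
  by rewrite vHE // in_fsetU sS.
rewrite -addnA vHE // in_fsetU; apply/orP; right.
by apply/mem_dblP; exists s, s'.
Qed.

Lemma mem_setH h : (h \in setH m S) = (h \in optsH (vH m S h)).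
Proof.
apply/idP/idP => [/set_mem hH|].
  suff [j hj] : exists j, h \in optsH j by rewrite (optsH_vH hj).
  case: hH => [[u [s [sS ->]]]|[u [s [s' [u_gt0 sS s'S ->]]]]]; exists u.
    by rewrite mem_cat; apply/orP; left; apply/optsAP; exists s.
  by rewrite mem_cat; apply/orP; right; apply/optsBP; exists s, s'.
rewrite mem_cat => /orP[/optsAP[s sS hE]|/optsBP[s [s' [j_gt0 sS s'S hE]]]].
  by apply/mem_set; left; exists (vH m S h), s.
by apply/mem_set; right; exists (vH m S h), s, s'.
Qed.

Lemma optsA_notB j h : h \in optsA j -> (h \in setB m S) = false.
Proof.
case/optsAP=> s sS ->; apply/negP => /set_mem[u [s1 [s2 [_ s1S s2S]]]].
rewrite -addnA => eq_h; case: S_free => _ /(_ _ _ _ s1S s2S sS); apply.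
by rewrite -(modnMDl u) -eq_h modnMDl.
Qed.

Lemma optsB_B j h : h \in optsB j -> h \in setB m S.
Proof. by case/optsBP=> s [s' [? ? ? ->]]; apply/mem_set; exists j, s, s'. Qed.

Lemma optsA_uniq j : uniq (optsA j).
Proof. by rewrite map_inj_uniq ?fset_uniq // => s s' /addnI. Qed.

Lemma optsH_uniq j : uniq (optsH j).
Proof.
rewrite cat_uniq optsA_uniq /=; apply/andP; split.
  by apply/hasPn => h /optsB_B hB; apply/negP => /optsA_notB; rewrite hB.
rewrite /optsB; case: ifP => // _.
by rewrite map_inj_uniq ?fset_uniq // => s s' /addnI.
Qed.

Lemma optsH_bounds j h : h \in optsH j -> j <= h /\ 0 < h.
Proof.
rewrite mem_cat => /orP[/optsAP[s /S_gt0 s_gt0 ->]|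
  /optsBP[s [s' [_ /S_gt0 s_gt0 _ ->]]]]; nia.
Qed.

(** Grouping ordered pairs by their sum: this is how the weights r(h) turn the parts of B into
    x^2. *)
Lemma sum_dbl (f : nat -> nat) :
  \sum_(t <- dbl S) #|[set x : S * S | fsval x.1 + fsval x.2 == t]| * f t =
  \sum_(s <- S) \sum_(s' <- S) f (s + s').
Proof.
transitivity (\sum_(x : S * S) f (val x.1 + val x.2)); last first.
  rewrite big_seq_fsetE /=.
  under [RHS]eq_bigr do rewrite big_seq_fsetE /=.
  by rewrite pair_big.
transitivity (\sum_(t <- dbl S) \sum_(x : S * S | val x.1 + val x.2 == t) f t).
  apply: eq_bigr => t _; rewrite sum_nat_const; congr (_ * _).
  by apply: eq_card => x; rewrite inE.
rewrite (exchange_big_dep predT) //=; apply: eq_bigr => x _.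
rewrite -big_filter; set t := _ + _.
suff E : perm_eq [seq t' <- dbl S | t == t'] [:: t].
  by rewrite (perm_small_eq _ E) // big_seq1.
apply: uniq_perm => //; first by rewrite filter_uniq ?fset_uniq.
move=> t'; rewrite mem_filter inE eq_sym; case: eqP => //= ->.
by apply/mem_dblP; exists (val x.1), (val x.2); rewrite !fsvalP.
Qed.

(** In [gapH] the required gap depends only on the lower part, so it can be attached to that
    part. *)
Definition min_gapH (h : nat) := if h \in setB m S then 4 else 3.
Definition weightH (h : nat) := if h \in setB m S then 2 else 1.

(** * Recurrences for both kinds of chains, and their equality *)

Lemma csumA_rec K j psi : vanish K psi ->
  csum optsA (fun=> 1) (fun=> 1) (fun=> 1) K j psi =
  csum optsA (fun=> 1) (fun=> 1) (fun=> 1) K j.+1 psi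
  + csum optsA (fun=> 1) (fun=> 1) (fun=> 1) K j.+1 (mulx S (shiftq m j psi)).
Proof.
move=> psi0; rewrite (csum_rec _ _ _ _ _ psi0) //.
  rewrite big_map csum_sum; congr (_ + _); apply: eq_bigr => s _.
  rewrite mul1n addn1; congr csum; apply/funext => k; apply/funext => n.
  by rewrite /shiftq add1n addnA.
by move=> i h /optsAP[s _ ->]; nia.
Qed.

Lemma csumH_rec K j psi : vanish K psi ->
  csum optsH min_gapH weightH (rH m S) K j psi =
  csum optsH min_gapH weightH (rH m S) K j.+1 psi
  + csum optsH min_gapH weightH (rH m S) K (j + 3) (mulx S (shiftq m j psi))
  + (if 0 < j then
     csum optsH min_gapH weightH (rH m S) K (j + 4)
       (mulx S (mulx S (shiftq m j psi)))
     else 0).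
Proof.
move=> psi0; rewrite (csum_rec _ _ _ _ _ psi0); first last.
- by move=> i h /optsH_bounds[].
- by rewrite /weightH => h; case: ifP.
- by rewrite /min_gapH => h; case: ifP.
rewrite -addnA big_cat /=; congr (_ + (_ + _)).
  rewrite csum_sum big_map [LHS]big_seq [RHS]big_seq; apply: eq_bigr => s sS.
  have hA : j * m + s \in optsA j by apply/optsAP; exists s.
  rewrite /min_gapH /rH /weightH (optsA_notB hA) mul1n; congr csum.
  by apply/funext => k; apply/funext => n; rewrite /shiftq add1n addnA.
rewrite /optsB; case: ifPn => j_gt0; last by rewrite big_nil.
rewrite big_map csum_sum.
under [RHS]eq_bigr do rewrite csum_sum.
pose f t := csum optsH min_gapH weightH (rH m S) K (j + 4)
  (fun k n => psi k.+2 (j * m + (t + n))).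
transitivity (\sum_(s <- S) \sum_(s' <- S) f (s + s')); last first.
  apply: eq_bigr => s _; apply: eq_bigr => s' _; congr csum.
  by apply/funext => k; apply/funext => n; congr psi; lia.
rewrite -sum_dbl [LHS]big_seq [RHS]big_seq; apply: eq_bigr => t tS.
have hB : j * m + t \in optsB j by rewrite /optsB j_gt0 map_f.
rewrite /min_gapH /rH /weightH (optsB_B hB) tHE ?in_fsetU ?tS ?orbT //.
congr (_ * csum _ _ _ _ _ _ _).
by apply/funext => k; apply/funext => n; rewrite add2n addnA.
Qed.

Lemma csumH_eq_csumA K psi : vanish K psi ->
  csum optsH min_gapH weightH (rH m S) K 0 psi =
  csum optsA (fun=> 1) (fun=> 1) (fun=> 1) K 0 psi.
Proof.
(* At level 0 the term for B is absent, which leaves N_1 + x N_3. *)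
move=> psi0; rewrite csumH_rec // addn0 add0n shiftq0.
apply: (N_eq_D m_gt0 _ _ _ _ psi0 psi0).
- move=> M j phi phi0 leMj; apply: csum_high phi0 leMj => [h|i h].
    by rewrite /weightH; case: ifP.
  by case/optsH_bounds.
- by move=> j phi phi0 j_gt0; rewrite csumH_rec // j_gt0.
- move=> M j phi phi0 leMj; apply: csum_high phi0 leMj => // i h.
  by case/optsAP=> s _ ->; nia.
- by move=> j phi phi0; rewrite csumA_rec.
Qed.

Lemma sum_calH n : \sum_(p in calH m S n) \prod_(h <- parts p) rH m S h =
  csum optsH min_gapH weightH (rH m S) n.+1 0 (fun _ s => s == n).
Proof.
apply: (sum_intpart_chains (lev := vH m S)) => //.
- by rewrite /min_gapH => h; case: ifP.
- by move=> i h /optsH_bounds[].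
- by move=> i h; apply: optsH_vH.
- exact: optsH_uniq.
- by move=> h; rewrite -mem_setH.
- by move=> h /=; rewrite mem_setH => /optsH_bounds[].
- by move=> a b; rewrite /gapH /min_gapH; case: ifP => _ /=; lia.
Qed.

Lemma pA_csum n : pA m S n =
  csum optsA (fun=> 1) (fun=> 1) (fun=> 1) n.+1 0 (fun _ s => s == n).
Proof.
transitivity (\sum_(p in calA m S n) \prod_(a <- parts p) 1).
  by rewrite /pA -sum1_card; apply: eq_bigr => p _; rewrite big1.
apply: (sum_intpart_chains (lev := uA m S)) => //.
- by move=> i h /optsAP[s _ ->]; nia.
- by move=> i h /optsAP[s sS ->]; apply: uAE.
- exact: optsA_uniq.
- by move=> h; rewrite -mem_setA.
- by move=> h /=; rewrite mem_setA => /optsAP[s /S_gt0 s_gt0 ->]; lia.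
- by move=> a b; rewrite addn1.
Qed.

Lemma pA_eq_sum_calH n :
  pA m S n = \sum_(p in calH m S n) \prod_(h <- parts p) rH m S h.
Proof.
(* The indicator of sum n vanishes from n + 1 on, which is also the fuel. *)
rewrite pA_csum sum_calH csumH_eq_csumA // => k s _ ltns.
by case: eqP => // eq_sn; lia.
Qed.

End SumFree.

Theorem theorem3 (m : nat) (S : {fset nat})
  (hm : 2 <= m)
  (hS0 : S <> fset0)
  (hSpos : forall s : nat, s \in S -> 0 < s)
  (hSfree : sum_free_mod m S)
  (hSsum : forall s1 s2 s3 s4 : nat,
     s1 \in S -> s2 \in S -> s3 \in S -> s4 \in S ->
     s1 + s2 = s3 + s4 %[mod m] -> s1 + s2 = s3 + s4) :
  [/\ (forall a : nat, setA m S a ->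
         exists! us : nat * nat, is_rep m S a us),
      (forall h : nat, setH m S h ->
         exists! vt : nat * nat, is_rep m (S `|` dbl S)%fset h vt)
    & (forall n : nat, 0 < n ->
         pA m S n =
         \sum_(p in calH m S n) \prod_(h <- parts p) rH m S h)].
Proof.
have m_gt0 : 0 < m by apply: ltnW.
have [S_inj _] := hSfree.
split=> [a [u [s [sS eq_a]]]|h hH|n _].
- have us_rep : is_rep m S a (u, s) by [].
  by exists (u, s); split=> // us; apply: (rep_unique m_gt0 S_inj us_rep).
- suff [vt vt_rep] : exists vt, is_rep m (S `|` dbl S)%fset h vt.
    exists vt; split=> // vt'.
    exact: (rep_unique m_gt0 (S_dbl_inj hSfree hSsum) vt_rep).
  case: hH => [[u [s [sS eq_h]]]|[u [s [s' [_ sS s'S eq_h]]]]].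
    by exists (u, s); split; rewrite //= in_fsetU sS.
  exists (u, s + s'); split; rewrite /= ?addnA //.
  by rewrite in_fsetU; apply/orP; right; apply/mem_dblP; exists s, s'.
- exact: pA_eq_sum_calH.
Qed.
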